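(* For any $P \in \mathcal P(\mathbb S^{d-1})$ and $\alpha \ge 0$ we have $$\mathrm{ahD}_\alpha(P) = \mathbb S^{d-1} \cap \bigcap \left\{ G : G^{\mathsf c} \in \mathcal H_0 \text{ and } P(G^{\mathsf c}) < \alpha \right\}.$$ In particular, the angular halfspace depth satisfies both of the following properties for all $P \in \mathcal P(\mathbb S^{d-1})$: (a) (Monotonicity along great circles) $$\mathrm{ahD}(x;P) \le \mathrm{ahD}\left( \frac{\mu + \alpha(x-\mu)}{\|\mu + \alpha(x-\mu)\|};P\right)$$ for all $x \in \mathbb S^{d-1}\setminus\{-\mu\}$ and $\alpha \in [0,1]$, where $\mu \in \mathbb S^{d-1}$ is any point that satisfies $\mathrm{ahD}(\mu;P) = \sup_{y \in \mathbb S^{d-1}} \mathrm{ahD}(y;P)$; (b) (Quasi-concavity) all central regions $\mathrm{ahD}_\alpha(P)$ with $\alpha \ge 0$ are spherical convex sets.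
   Context: Let $d \ge 2$ be an integer, $\mathbb S^{d-1} = \{x \in \mathbb R^d : \|x\| = 1\}$, and let $\mathcal P(\mathbb S^{d-1})$ be the set of Borel probability measures on $\mathbb S^{d-1}$. For a Borel set $A \subseteq \mathbb R^d$ and $P \in \mathcal P(\mathbb S^{d-1})$, write $P(A) = P(A \cap \mathbb S^{d-1})$. For $u \in \mathbb S^{d-1}$ let $H_{0,u} = \{y \in \mathbb R^d : \langle y,u\rangle \ge 0\}$, and let $\mathcal H_0 = \{H_{0,u} : u \in \mathbb S^{d-1}\}$ be the set of closed halfspaces in $\mathbb R^d$ whose boundary passes through the origin; $G^{\mathsf c}$ is the complement of $G$ in $\mathbb R^d$, so the sets $G$ in the claim are open halfspaces whose boundary passes through the origin. An intersection over the empty family is $\mathbb R^d$. The angular halfspace depth of $x \in \mathbb S^{d-1}$ with respect to $P$ is $$\mathrm{ahD}(x;P) = \inf\{P(H_{0,u}) : u \in \mathbb S^{d-1} \text{ and } x \in H_{0,u}\},$$ and its central regions are $\mathrm{ahD}_\alpha(P) = \{x \in \mathbb S^{d-1} : \mathrm{ahD}(x;P) \ge \alpha\}$. A set $A \subseteq \mathbb S^{d-1}$ is called spherical convex if its radial extension $\{\lambda a \in \mathbb R^d : a \in A \text{ and } \lambda > 0\}$ is convex in $\mathbb R^d$.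
   Formalization: In (b), spherical convexity is claimed only for central regions other than the whole sphere: with λ > 0 the radial extension of the whole sphere (the region at α = 0) is R^d without the origin, which is not convex. *)

(* Defs.v *)
From HB Require Import structures.
From mathcomp Require Import all_boot all_order all_algebra.
From mathcomp Require Import all_classical all_reals all_analysis.

Set Implicit Arguments.
Unset Strict Implicit.
Unset Printing Implicit Defensive.

Import Order.TTheory GRing.Theory Num.Theory.
Import numFieldNormedType.Exports.

Local Open Scope classical_set_scope.
Local Open Scope ring_scope.

Section Euclidean.
Variables (R : realType) (d : nat).

Definition dotp (x y : 'rV[R]_d) : R := \sum_(i < d) x 0 i * y 0 i.

(* The library norm `|x| on row vectors is the sup norm, which induces the
   same topology, hence the same Borel sets, but not the same unit sphere. *)
Definition enorm (x : 'rV[R]_d) : R := Num.sqrt (dotp x x).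

Definition sphere : set 'rV[R]_d := [set x | enorm x = 1].

Definition halfspace0 (u : 'rV[R]_d) : set 'rV[R]_d := [set y | 0 <= dotp y u].

Definition halfspaces0 : set (set 'rV[R]_d) := [set halfspace0 u | u in sphere].

Definition radial_extension (A : set 'rV[R]_d) : set 'rV[R]_d :=
  [set y | exists a l, [/\ A a, 0 < l & y = l *: a]].

(* The radial extension omits the origin, so a spherical convex set contains no
   antipodal points; in particular the whole sphere is not spherical convex. *)
Definition spherical_convex (A : set 'rV[R]_d) : Prop :=
  A `<=` sphere /\
  convex_set (radial_extension A : set (convex_lmodType 'rV[R]_d)).

End Euclidean.

Arguments sphere R d : clear implicits.

Lemma sphere_delta (R : realType) (d : nat) (i : 'I_d) :
  sphere R d (delta_mx 0 i).
Proof.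
rewrite /sphere /= /enorm /dotp (bigD1 i)//= !mxE !eqxx/= mulr1 big1 ?addr0.
  exact: sqrtr1.
by move=> j ji; rewrite !mxE eqxx (negbTE ji) mul0r.
Qed.

(* The sphere as a subtype of R^d, with the subspace topology. Measurable types
   are pointed in the library; the proof argument provides the point. *)
Definition sphere_type (R : realType) (d : nat) (d_ge2 : (2 <= d)%N) : Type :=
  set_type (sphere R d).

Section SphereType.
Variables (R : realType) (d : nat) (d_ge2 : (2 <= d)%N).

HB.instance Definition _ := Topological.copy (@sphere_type R d d_ge2)
  (set_type (sphere R d)).

Let sphere_point : @sphere_type R d d_ge2 :=
  SigSub (mem_set (sphere_delta R (Ordinal (ltnW d_ge2)))).

HB.instance Definition _ := isPointed.Build (@sphere_type R d d_ge2)
  sphere_point.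

End SphereType.

Arguments sphere_type R {d} d_ge2.

Definition sphere_borel (R : realType) (d : nat) (d_ge2 : (2 <= d)%N) :=
  g_sigma_algebraType (@open (sphere_type R d_ge2)).

Arguments sphere_borel R {d} d_ge2.

Section Depth.
Variables (R : realType) (d : nat) (d_ge2 : (2 <= d)%N).
Variable P : probability (sphere_borel R d_ge2) R.

(* P (A `&` sphere): P lives on the sphere, A is a subset of R^d. *)
Definition mass (A : set 'rV[R]_d) : \bar R :=
  P ((set_val : set_type (sphere R d) -> 'rV[R]_d) @^-1` A).

(* Angular halfspace depth; meant for x on the sphere. *)
Definition ahD (x : 'rV[R]_d) : \bar R :=
  ereal_inf [set mass (halfspace0 u) |
             u in [set u | sphere R d u /\ halfspace0 u x]].

Definition ahD_region (alpha : R) : set 'rV[R]_d :=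
  [set x | sphere R d x /\ (alpha%:E <= ahD x)%E].

End Depth.

(* Main.v *)
Require Import Defs.
From HB Require Import structures.
From mathcomp Require Import all_boot all_order all_algebra.
From mathcomp Require Import all_classical all_reals all_analysis.
From mathcomp Require Import lra.
Import Order.TTheory GRing.Theory Num.Theory.
Import numFieldNormedType.Exports.
Local Open Scope classical_set_scope.
Local Open Scope ring_scope.


(** The depth is an infimum over closed halfspaces through the origin, so it
    makes sense for every vector of R^d, and [ahD P x] is at least [a] exactly
    when no such halfspace of mass less than [a] contains [x] ([le_ahDP]). The
    representation of the central regions is the contrapositive of this, read
    for the complementary open halfspaces.

    Everything else follows from two facts about this extension of the depth.
    It is constant along open rays ([ahD_scale]), hence invariant under
    normalization ([ahD_normalize]); and it is quasi-concave on R^d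
    ([ahD_quasiconcave]), since a closed halfspace through the origin that
    contains a point of a segment contains one of its endpoints.

    For the monotonicity, the depth of the normalized point of the segment from
    [mu] to [x] is at least the minimum of the depths of [mu] and [x], and this
    is the depth of [x] because [mu] is deepest. For the spherical convexity,
    the radial extension of a central region is the upper level set of the
    extended depth with the origin removed. Upper level sets are convex by
    quasi-concavity; and the origin, which lies in all the halfspaces, is in
    this level set only if every vector is, that is, if the central region is
    the whole sphere. *)

Section EuclideanTheory.
Variables (R : realType) (d : nat).
Implicit Types (x y u : 'rV[R]_d) (c : R).

Lemma dotpDl x y u : dotp (x + y) u = dotp x u + dotp y u.
Proof.
by rewrite /dotp -big_split; apply: eq_bigr => i _; rewrite !mxE mulrDl.
Qed.

Lemma dotpZl c x u : dotp (c *: x) u = c * dotp x u.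
Proof.
by rewrite /dotp mulr_sumr; apply: eq_bigr => i _; rewrite !mxE mulrA.
Qed.

Lemma dotp0l u : dotp 0 u = 0.
Proof. by rewrite -(scale0r 0) dotpZl mul0r. Qed.

Lemma enorm_ge0 x : 0 <= enorm x.
Proof. exact: sqrtr_ge0. Qed.

Lemma enormZ c x : 0 <= c -> enorm (c *: x) = c * enorm x.
Proof.
move=> c0; rewrite /enorm.
have -> : dotp (c *: x) (c *: x) = c ^+ 2 * dotp x x.
  by rewrite /dotp mulr_sumr; apply: eq_bigr => i _; rewrite !mxE mulrACA.
by rewrite sqrtrM ?sqr_ge0// sqrtr_sqr ger0_norm.
Qed.

Lemma enorm0_eq0 x : enorm x = 0 -> x = 0.
Proof.
have sq_ge0 (i : 'I_d) : true -> 0 <= x 0 i * x 0 i.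
  by move=> _; rewrite -expr2 sqr_ge0.
move/eqP; rewrite sqrtr_eq0 => xx_le0.
have xx0 : dotp x x = 0 by apply/le_anti; rewrite xx_le0 sumr_ge0.
apply/rowP => i; rewrite mxE; apply/eqP.
by rewrite -sqrf_eq0 expr2; apply/eqP; exact: (psumr_eq0P sq_ge0 xx0).
Qed.

Lemma sphere_neq0 x : sphere R d x -> x <> 0.
Proof.
move=> x1 x0; move: x1; rewrite /sphere /= x0 /enorm dotp0l sqrtr0.
by move/eqP; rewrite eq_sym oner_eq0.
Qed.

Lemma sphere_normalize x : x <> 0 -> sphere R d ((enorm x)^-1 *: x).
Proof.
move=> x0; rewrite /sphere /= enormZ ?invr_ge0 ?enorm_ge0// mulVf//.
by apply/eqP => /enorm0_eq0.
Qed.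

Lemma halfspace0_scale c x u : 0 < c -> halfspace0 u (c *: x) = halfspace0 u x.
Proof. by move=> c0; rewrite /halfspace0 /= dotpZl pmulr_rge0. Qed.

Lemma halfspace0_conv c x y u : 0 <= c <= 1 ->
  halfspace0 u ((1 - c) *: x + c *: y) -> halfspace0 u x \/ halfspace0 u y.
Proof.
move=> /andP[c0 c1]; rewrite /halfspace0 /= dotpDl !dotpZl => conv_ge0.
have [x_ge0|x_lt0] := leP 0 (dotp x u); first by left.
have [y_ge0|y_lt0] := leP 0 (dotp y u); first by right.
by exfalso; nra.
Qed.

End EuclideanTheory.

Section DepthTheory.
Variables (R : realType) (d : nat) (d_ge2 : (2 <= d)%N).
Variable P : probability (sphere_borel R d_ge2) R.
Implicit Types (x y u : 'rV[R]_d) (c alpha : R) (a : \bar R).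

Lemma le_ahDP a x : (a <= ahD P x)%E <->
  forall u, sphere R d u -> halfspace0 u x -> (a <= mass P (halfspace0 u))%E.
Proof.
split=> [le_a u u1 ux|le_a].
  by apply: (le_trans le_a); apply: ereal_inf_lbound; exists u.
by apply: le_ereal_inf_tmp => _ [u [u1 ux] <-]; exact: le_a.
Qed.

Lemma ahD_region_bigcap alpha : ahD_region P alpha =
  sphere R d `&` \bigcap_(G in [set G : set 'rV[R]_d |
    halfspaces0 (~` G) /\ (mass P (~` G) < alpha%:E)%E]) G.
Proof.
apply/seteqP; split=> x [x1 deep]; split=> //.
  move=> G [[u u1 GE] massG]; apply: contrapT => nGx.
  move: massG; rewrite ltNge => /negP; apply; rewrite -GE.
  by move/le_ahDP: deep; apply => //; rewrite GE.
apply/le_ahDP => u u1 ux; rewrite leNgt; apply/negP => mass_lt.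
suff : (~` halfspace0 u) x by apply.
by apply: deep; rewrite /= setCK; split=> //; exists u.
Qed.

Lemma ahD_scale c x : 0 < c -> ahD P (c *: x) = ahD P x.
Proof.
move=> c0; rewrite /ahD; congr (ereal_inf (image _ _)).
by apply/seteqP; split=> u /=; rewrite halfspace0_scale.
Qed.

(** At the origin the factor is [0^-1], that is 0, and the vector stays put. *)
Lemma ahD_normalize x : ahD P ((enorm x)^-1 *: x) = ahD P x.
Proof.
have [->|/eqP x0] := eqVneq x 0; first by rewrite scaler0.
rewrite ahD_scale// invr_gt0 lt_neqAle enorm_ge0 andbT eq_sym.
by apply/eqP => /enorm0_eq0.
Qed.

(** A halfspace that competes in the infimum at a point of the segment competes
    in the infimum at one of the endpoints. *)
Lemma ahD_quasiconcave a c x y : 0 <= c <= 1 ->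
  (a <= ahD P x)%E -> (a <= ahD P y)%E ->
  (a <= ahD P ((1 - c) *: x + c *: y))%E.
Proof.
move=> c01 /le_ahDP ax /le_ahDP ay; apply/le_ahDP => u u1.
by case/(halfspace0_conv _ _ _ _ _ _ c01); [exact: ax|exact: ay].
Qed.

(** Every halfspace through the origin competes in the infimum at the origin,
    but only those that contain [x] in the infimum at [x]. *)
Lemma ahD0_le x : (ahD P 0 <= ahD P x)%E.
Proof.
apply/le_ahDP => u u1 _; have /le_ahDP : (ahD P 0 <= ahD P 0)%E by [].
by apply => //; rewrite /halfspace0 /= dotp0l.
Qed.

Lemma radial_extension_ahD_region alpha :
  radial_extension (ahD_region P alpha) =
  [set y | y <> 0 /\ (alpha%:E <= ahD P y)%E].
Proof.
apply/seteqP; split=> [_ [x [l [[x1 deep] l0 ->]]]|y [y0 deep]].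
  split; last by rewrite ahD_scale.
  move=> /eqP; rewrite scaler_eq0 (gt_eqF l0) => /eqP.
  exact: sphere_neq0.
have ny0 : enorm y != 0 by apply/eqP => /enorm0_eq0.
exists ((enorm y)^-1 *: y), (enorm y); split.
- by split; [exact: sphere_normalize|rewrite ahD_normalize].
- by rewrite lt_neqAle eq_sym ny0 enorm_ge0.
- by rewrite scalerA divff// scale1r.
Qed.

Lemma ahD_region_spherical_convex alpha :
  ahD_region P alpha <> sphere R d -> spherical_convex (ahD_region P alpha).
Proof.
move=> not_sphere; split; first by move=> x [].
have shallow0 : ~ (alpha%:E <= ahD P 0)%E.
  move=> deep0; apply: not_sphere; apply/seteqP; split=> [x []//|x x1].
  by split=> //; exact: le_trans deep0 (ahD0_le x).
rewrite radial_extension_ahD_region => x y l.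
rewrite !inE /= => -[x0 deepx] [y0 deepy].
have deep : (alpha%:E <= ahD P (conv l x y))%E.
  (* [conv l] puts the weight [l] on its first argument. *)
  have -> : conv l x y = (1 - l%:num) *: (y : 'rV[R]_d) + l%:num *: x.
    by rewrite addrC.
  apply: (ahD_quasiconcave _ _ y x) => //.
  by rewrite ge0 le1.
by split=> // xy0; apply: shallow0; rewrite -xy0.
Qed.

Lemma ahD_monotone mu x c : sphere R d x ->
  ahD P mu = ereal_sup [set ahD P y | y in sphere R d] -> 0 <= c <= 1 ->
  (ahD P x <=
   ahD P ((enorm (mu + c *: (x - mu)))^-1 *: (mu + c *: (x - mu))))%E.
Proof.
move=> x1 mu_max c01; rewrite ahD_normalize.
have -> : mu + c *: (x - mu) = (1 - c) *: mu + c *: x.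
  by rewrite scalerBr scalerBl scale1r addrA addrAC.
apply: ahD_quasiconcave => //.
by rewrite mu_max; apply: ereal_sup_ubound; exists x.
Qed.

End DepthTheory.

Theorem theorem4 (R : realType) (d : nat) (d_ge2 : (2 <= d)%N)
    (P : probability (sphere_borel R d_ge2) R) :
  [/\ (forall alpha : R, 0 <= alpha ->
         ahD_region P alpha =
         sphere R d `&`
           \bigcap_(G in [set G : set 'rV[R]_d |
             halfspaces0 (~` G) /\ (mass P (~` G) < alpha%:E)%E]) G),
      (forall mu : 'rV[R]_d, sphere R d mu ->
         ahD P mu = ereal_sup [set ahD P y | y in sphere R d] ->
         forall (x : 'rV[R]_d) (alpha : R),
           sphere R d x -> x <> - mu -> 0 <= alpha <= 1 ->
           (ahD P x <=
            ahD P ((enorm (mu + alpha *: (x - mu)))^-1 *: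
                     (mu + alpha *: (x - mu))))%E)
    & (forall alpha : R, 0 <= alpha -> ahD_region P alpha <> sphere R d ->
         spherical_convex (ahD_region P alpha))].
Proof.
split.
- by move=> alpha _; exact: ahD_region_bigcap.
- by move=> mu _ mu_max x alpha x1 _; exact: ahD_monotone.
- by move=> alpha _; exact: ahD_region_spherical_convex.
Qed.
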